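(* Let $0<\alpha\le 1$ and let $f,g\in\mathcal{S}(\mathbb{R})$ be Schwartz functions. Then for every $\xi\in\mathbb{R}$, $$D_{\xi}^{\alpha} f\cdot g(\xi)=\frac{1}{(2\pi)^{2}}\int_{\mathbb{R}}\int_{\mathbb{R}}\Bigl[(ik_1)^{\alpha}-(ik_2)^{\alpha}\Bigr]\,\widehat{f}(k_1)\,\widehat{g}(k_2)\,e^{i(k_1+k_2)\xi}\,dk_1\,dk_2 .$$ In particular, for $\theta_j=k_j\xi+\delta_j$ $(j=1,2)$ with constants $k_j,\delta_j\in\mathbb{C}$, $$D_{\xi}^{\alpha} e^{\theta_1}\cdot e^{\theta_2}=\bigl(k_1^{\alpha}-k_2^{\alpha}\bigr)\,e^{\theta_1+\theta_2},$$ where $k^{\alpha}$ is taken in the principal branch when $k$ is complex.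
   Context: Fourier transform convention: $\widehat{f}(k)=\int_{\mathbb{R}} f(\xi)e^{-ik\xi}\,d\xi$, with inverse $f(\xi)=\frac{1}{2\pi}\int_{\mathbb{R}}\widehat{f}(k)e^{ik\xi}\,dk$, extended in the usual way to tempered distributions. For $0<\alpha\le 1$ the spectral fractional derivative $D_\xi^\alpha f$ of a single function $f\in\mathcal{S}(\mathbb{R})$ is defined by $\widehat{D_\xi^\alpha f}(k)=(ik)^\alpha\widehat{f}(k)$, where $(ik)^\alpha$ is the principal branch (with $0^\alpha=0$); it extends to tempered distributions. The spectral fractional Hirota bilinear operator is defined on pairs by $$D_\xi^\alpha f\cdot g:=(D_\xi^\alpha f)\,g-f\,(D_\xi^\alpha g).$$ Here $D_\xi^\alpha f\cdot g$ always denotes this bilinear operator applied to the pair $(f,g)$, not the product of $D_\xi^\alpha f$ with $g$. Exponentials: Fourier modes $e^{i\kappa\xi}$ ($\kappa\in\mathbb{R}$) are tempered distributions and satisfy $D_\xi^\alpha e^{i\kappa\xi}=(i\kappa)^\alpha e^{i\kappa\xi}$. For general complex $k,\delta$, the function $e^{k\xi+\delta}$ need not be tempered, and the action of $D_\xi^\alpha$ on it is understood by analytic continuation in $k$ of this formula with the principal-branch convention, i.e. $D_\xi^\alpha e^{k\xi+\delta}:=k^\alpha e^{k\xi+\delta}$; the bilinear operator on exponentials is then given by the displayed definition. *)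

(* Defs.v *)
From HB Require Import structures.
From mathcomp Require Import all_boot all_order all_algebra.
From mathcomp Require Import complex.
From mathcomp Require Import all_classical all_reals all_analysis.

Set Implicit Arguments.
Unset Strict Implicit.
Unset Printing Implicit Defensive.

Import Order.TTheory GRing.Theory Num.Theory.
Import numFieldNormedType.Exports.

Local Open Scope classical_set_scope.
Local Open Scope ring_scope.
Local Open Scope complex_scope.

Section ComplexFunctions.
Variable R : realType.
Implicit Types (z w : R[i]) (a : R).

Definition cexp z : R[i] :=
  (expR (complex.Re z) * cos (complex.Im z))
    +i* (expR (complex.Re z) * sin (complex.Im z)).

(* Principal argument, with values in ]-pi, pi]; it is pi on the negative real
   axis.  Irrelevant junk value at 0. *)
Definition carg z : R :=
  if 0 <= complex.Im z then acos (complex.Re z / Normc.normc z)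
  else - acos (complex.Re z / Normc.normc z).

Definition clog z : R[i] := ln (Normc.normc z) +i* carg z.

(* The value at 0 is 0 for every exponent; only exponents a > 0 are used. *)
Definition cpow z a : R[i] := if z == 0 then 0 else cexp (a%:C * clog z).

End ComplexFunctions.

Section SpectralDerivative.
Variable R : realType.
Implicit Types (f g : R -> R[i]) (alpha xi : R).

Definition Cintegral f : R[i] :=
  (\int[lebesgue_measure]_x complex.Re (f x))%R
    +i* (\int[lebesgue_measure]_x complex.Im (f x))%R.

Definition schwartz_real (u : R -> R) : Prop :=
  (forall (n : nat) (x : R), derivable (derive1n n u) x 1) /\
  (forall m n : nat, exists M : R, forall x : R, `|x ^+ m * derive1n n u x| <= M).

Definition schwartz f : Prop :=
  schwartz_real (fun x => complex.Re (f x)) /\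
  schwartz_real (fun x => complex.Im (f x)).

(* The notation x*i stands for the purely imaginary number 0 +i* x. *)
Definition fourier f (k : R) : R[i] :=
  Cintegral (fun xi => f xi * cexp (- (k * xi)*i)).

Definition inv_fourier f (xi : R) : R[i] :=
  ((2 * pi)^-1)%:C * Cintegral (fun k => f k * cexp ((k * xi)*i)).

Definition expfun (k delta : R[i]) (xi : R) : R[i] := cexp (k * xi%:C + delta).

Definition exp_rates f : set R[i] :=
  [set k | exists delta : R[i], f = expfun k delta].

(* D^alpha on the two classes of functions on which it is used: an exponential
   e^(k xi + delta), which determines k, is multiplied by k^alpha (this is the
   analytic continuation in k of the action on the Fourier modes e^(i kappa xi));
   a Schwartz function, which is never an exponential, is acted upon by the
   Fourier multiplier (i k)^alpha. For such f, (i k)^alpha * fourier f k is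
   continuous and integrable in k, so its inverse transform is the classical
   integral. *)
Definition fracD alpha f : R -> R[i] :=
  if `[< exists k, exp_rates f k >]
  then fun xi => cpow (xget 0 (exp_rates f)) alpha * f xi
  else inv_fourier (fun k => cpow (k*i) alpha * fourier f k).

Definition hirota alpha f g (xi : R) : R[i] :=
  fracD alpha f xi * g xi - f xi * fracD alpha g xi.

End SpectralDerivative.

(* Main.v *)
Require Import Defs.
From HB Require Import structures.
From mathcomp Require Import all_boot all_order all_algebra.
From mathcomp Require Import complex.
From mathcomp Require Import all_classical all_reals all_analysis.
From mathcomp Require Import measurable_realfun lebesgue_integral_under.
From mathcomp Require Import ring lra.
Import Order.TTheory GRing.Theory Num.Theory.
Import numFieldNormedType.Exports.
Local Open Scope ring_scope.
Local Open Scope complex_scope.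

(** Everything rests on Fourier inversion.  Write m(k) = (ik)^alpha.  The kernel
    m(k1) - m(k2) splits the double integral into two terms, each a product of
    an integral in k1 and an integral in k2, so the right-hand side equals
    (2 pi)^-2 (A(f) B(g) - B(f) A(g)), where
      A(h) = int m(k) h^(k) e^{ik xi} dk   and   B(h) = int h^(k) e^{ik xi} dk.
    Here A(h) / 2 pi is D^alpha h (xi) by definition ([fracD_schwartz]), and
    B(h) / 2 pi is h(xi) by inversion ([fourier_inversion]); this is
    [hirota_schwartz].

    Two analytic facts about a real Schwartz function u are needed, and both are
    proved for the family
      cos_transform u k t = int u(x) cos(k x + t) dx,
    whose phase t lets one statement cover the cosine and the sine transforms as
    well as the factor e^{ik xi} (phase t - k xi).
    - Decay ([cos_transform_decay]): four integrations by parts bound it by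
      M / (1 + k^2)^2, uniformly in t.  Since |m(k)| <= 1 + |k| for
      0 <= alpha <= 1, this makes A(h) and B(h) absolutely convergent.
    - Inversion ([cos_transform_inversion]), by Abel summation.  Insert the factor
      e^{-e|k|}, exchange the integrals, and compute
        int e^{-e|k|} cos(k y + t) dk = cos t * 2e / (e^2 + y^2).
      This Poisson kernel is the derivative of y |-> 2 atan(y / e), so one more
      integration by parts turns the damped integral into
        - cos t * int u'(x) 2 atan((x - xi) / e) dx.
      As e -> 0, atan tends boundedly to (pi / 2) sgn, and the limit is
      - cos t * pi * int u'(x) sgn(x - xi) dx = 2 pi u(xi) cos t.

    For exponentials, the identity is immediate once D^alpha is known to act on
    e^{k x + d} as multiplication by k^alpha: the function determines its rate k
    ([expfun_rate_inj]).  The two descriptions of D^alpha do not interfere,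
    because a Schwartz function is never an exponential
    ([schwartz_not_expfun]). *)

Set Implicit Arguments.
Unset Strict Implicit.
Unset Printing Implicit Defensive.

(** * Integrals over unbounded sets *)

Section RealIntegrals.
Local Open Scope classical_set_scope.
Local Open Scope ring_scope.
Variable R : realType.
Notation mu := (@lebesgue_measure R).
Implicit Types (f g F u : R -> R) (D : set R).

Lemma Rdominated_cvg D (f_ : nat -> R -> R) f g : measurable D ->
  (forall n, measurable_fun D (f_ n)) -> measurable_fun D f ->
  (forall x, D x -> f_ n x @[n --> \oo] --> f x) ->
  mu.-integrable D (EFin \o g) ->
  (forall n x, D x -> `|f_ n x| <= g x) ->
  \int[mu]_(x in D) f_ n x @[n --> \oo] --> \int[mu]_(x in D) f x.
Proof.
move=> mD mf_ mf f_f ig f_g.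
have [] := @dominated_convergence _ _ _ mu _ mD (fun n => EFin \o f_ n)
  (EFin \o f) (EFin \o g).
- by move=> n; apply/measurable_EFinP; exact: mf_.
- exact/measurable_EFinP.
- apply: aeW => x Dx; apply: cvg_EFin; last exact: f_f.
  exact: nearW.
- exact: ig.
- by apply: aeW => x n Dx /=; rewrite lee_fin f_g.
move=> i_f _; rewrite /Rintegral => cv.
by apply: fine_cvg; rewrite fineK //; exact: integrable_fin_num.
Qed.

Lemma is_derive_continuous f g :
  (forall x : R, is_derive x 1 f (g x)) -> continuous f.
Proof.
move=> df x; apply/differentiable_continuous/derivable1_diffP.
exact: ex_derive.
Qed.

(** Dominated convergence along an exhaustion of [D] by compact intervals reduces
    the fundamental theorem on a half-line to the compact case, for integrands of
    any sign. *)
Lemma FTC2_exhaustion D f F (a b : nat -> R) (l : R) :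
  measurable D -> mu.-integrable D (EFin \o f) -> continuous f ->
  (forall x : R, is_derive x 1 F (f x)) ->
  (forall n, a n < b n) -> (forall n, `[a n, b n] `<=` D) ->
  (forall x, D x -> \forall n \near \oo, x \in `[a n, b n]) ->
  F (b n) - F (a n) @[n --> \oo] --> l ->
  \int[mu]_(x in D) f x = l.
Proof.
move=> mD intf cf dF ab abD exh cvF.
have cF := is_derive_continuous dF.
have mf : measurable_fun setT f by exact: continuous_measurable_fun.
have cvl : \int[mu]_(x in D) (f \_ `[a n, b n]) x @[n --> \oo] --> l.
  apply: cvg_trans cvF; apply: near_eq_cvg; apply: nearW => n.
  rewrite -Rintegral_mkcondr setIidr//.
  rewrite /Rintegral (@continuous_FTC2 _ f F)//.
  - exact: continuous_subspaceT.
  - split=> [x _||]; first exact: ex_derive.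
    + exact/cvg_at_right_filter/cF.
    + exact/cvg_at_left_filter/cF.
  - by move=> x _; rewrite derive1E; exact: derive_val.
apply: cvg_unique cvl => /=; first exact: Rhausdorff.
apply: (Rdominated_cvg (g := fun x => `|f x|)) => //.
- move=> n; apply: measurable_funTS.
  by apply/(measurable_restrictT f) => //; exact: measurable_funTS.
- exact: measurable_funTS.
- move=> x Dx; apply: cvg_near_cst.
  apply: filterS (exh x Dx) => n xab; by rewrite patchE ifT// inE.
- exact: (integrable_norm intf).
- by move=> n x _; rewrite patchE; case: ifPn => // _; rewrite normr0.
Qed.


Let cvg_itvS (F : R -> R) (l c : R) : F x @[x --> +oo] --> l ->
  F (c + n.+1%:R) @[n --> \oo] --> l.
Proof.
move=> /(cvg_comp _ _ _); apply.
apply/cvgryPge => A; near=> n.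
rewrite -lerBlDl (@le_trans _ _ n%:R)//; last by rewrite ler_nat.
near: n; exact: nbhs_infty_ger.
Unshelve. all: by end_near. Qed.

Let cvg_itvNS (F : R -> R) (l c : R) : F x @[x --> -oo] --> l ->
  F (c - n.+1%:R) @[n --> \oo] --> l.
Proof.
move=> /(cvg_comp _ _ _); apply.
apply/cvgrNyPle => A; near=> n.
rewrite lerBlDl -lerBlDr (@le_trans _ _ n%:R)//; last by rewrite ler_nat.
near: n; exact: nbhs_infty_ger.
Unshelve. all: by end_near. Qed.

Lemma FTC2cy f F (c l : R) : mu.-integrable `[c, +oo[ (EFin \o f) ->
  continuous f -> (forall x : R, is_derive x 1 F (f x)) ->
  F x @[x --> +oo] --> l -> \int[mu]_(x in `[c, +oo[) f x = l - F c.
Proof.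
move=> intf cf dF Fl.
apply: (FTC2_exhaustion (F := F) (a := fun=> c) (b := fun n => c + n.+1%:R)) => //.
- by move=> n; rewrite ltrDl.
- by move=> n x /=; rewrite !in_itv/= => /andP[->].
- move=> x /=; rewrite in_itv/= andbT => cx; near=> n.
  rewrite in_itv/= cx/= -lerBlDl (@le_trans _ _ n%:R)//; last by rewrite ler_nat.
  near: n; exact: nbhs_infty_ger.
- by apply: cvgB; [exact: cvg_itvS|exact: cvg_cst].
Unshelve. all: by end_near. Qed.

Lemma FTC2Nyc f F (c l : R) : mu.-integrable `]-oo, c] (EFin \o f) ->
  continuous f -> (forall x : R, is_derive x 1 F (f x)) ->
  F x @[x --> -oo] --> l -> \int[mu]_(x in `]-oo, c]) f x = F c - l.
Proof.
move=> intf cf dF Fl.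
apply: (FTC2_exhaustion (F := F) (a := fun n => c - n.+1%:R) (b := fun=> c)) => //.
- by move=> n; rewrite ltrBlDl ltrDr.
- by move=> n x /=; rewrite !in_itv/= => /andP[_ ->].
- move=> x /=; rewrite in_itv/= => cx; near=> n.
  rewrite in_itv/= cx/= andbT lerBlDl -lerBlDr.
  rewrite (@le_trans _ _ n%:R)//; last by rewrite ler_nat.
  near: n; exact: nbhs_infty_ger.
- by apply: cvgB; [exact: cvg_cst|exact: cvg_itvNS].
Unshelve. all: by end_near. Qed.

Lemma Rintegral_split f (c : R) : mu.-integrable setT (EFin \o f) ->
  \int[mu]_x f x = \int[mu]_(x in `]-oo, c]) f x + \int[mu]_(x in `[c, +oo[) f x.
Proof.
move=> intf; rewrite -(Rintegral_itv_obnd_cbnd (r := c)); last first.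
  by apply: integrableS intf.
rewrite -Rintegral_setU//=.
- by rewrite -setCitvr setvU.
- by rewrite -setCitvr setvU.
- by rewrite -setCitvr disj_set_sym; apply/disj_setPCl.
Qed.

Lemma FTC2T f F (l l' : R) : mu.-integrable setT (EFin \o f) ->
  continuous f -> (forall x : R, is_derive x 1 F (f x)) ->
  F x @[x --> -oo] --> l' -> F x @[x --> +oo] --> l -> \int[mu]_x f x = l - l'.
Proof.
move=> intf cf dF Fl' Fl; rewrite (Rintegral_split 0)//.
rewrite (FTC2Nyc _ _ dF Fl')//; last by apply: integrableS intf.
rewrite (FTC2cy _ _ dF Fl)//; last by apply: integrableS intf.
by rewrite addrC addrA subrK.
Qed.

(** The reference function for absolute convergence: its antiderivative [atan] is
    bounded. *)
Lemma integrable_oneDsqrV : mu.-integrable setT (fun x : R => (1 + x ^+ 2)^-1%:E).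
Proof.
have mV : measurable_fun setT (fun x : R => (1 + x ^+ 2)^-1%:E).
  apply/measurable_EFinP; apply: continuous_measurable_fun.
  exact: (@continuous_oneDsqrV R).
apply/integrableP; split => //; apply/abse_integralP => //=.
rewrite ge0_symfun_integralT//=.
- rewrite -set_itvcy (_ : (\int[_]_(x in _) _)%E = (pi / 2)%:E).
    by rewrite -EFinM ltry.
  exact: integral0y_oneDsqr.
- by move=> x; rewrite invr_ge0 addr_ge0// sqr_ge0.
- exact: (@continuous_oneDsqrV R).
- by move=> x /=; rewrite sqrrN.
Qed.

Definition quadratic_decay f := exists M, forall x, `|f x| <= M / (1 + x ^+ 2).

Lemma integrable_quadratic_decay f : measurable_fun setT f -> quadratic_decay f ->
  mu.-integrable setT (EFin \o f).
Proof.
move=> mf [M fM].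
apply: (le_integrable _ _ _ (integrableZl _ M integrable_oneDsqrV)) => //=.
- exact/measurable_EFinP.
- by move=> x _; rewrite lee_fin (le_trans (fM x)) ?ler_norm.
Qed.

Lemma integrable_bounded_mul f g C : mu.-integrable setT (EFin \o f) ->
  measurable_fun setT g -> (forall x, `|g x| <= C) ->
  mu.-integrable setT (EFin \o (fun x => f x * g x)).
Proof.
move=> intf mg gC; have mf : measurable_fun setT f.
  by apply/measurable_EFinP; exact: measurable_int intf.
apply: (le_integrable _ _ _ (integrableZl _ C intf)) => //=.
- by apply/measurable_EFinP; exact: measurable_funM.
- move=> x _; rewrite lee_fin !normrM mulrC ler_wpM2r//.
  by rewrite (le_trans (gC x)) ?ler_norm.
Qed.

End RealIntegrals.

(** * Real Schwartz functions *)

Section Schwartz.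
Local Open Scope classical_set_scope.
Variable R : realType.
Notation mu := (@lebesgue_measure R).
Implicit Types (f g F u : R -> R) (D : set R).

Lemma schwartz_derive1 u : schwartz_real u -> schwartz_real u^`().
Proof.
case=> du bu; split=> [n x|m n].
- by rewrite -derive1Sn; exact: du.
- by have [M bM] := bu m n.+1; exists M => x; rewrite -derive1Sn.
Qed.

Lemma schwartz_derive1n u n : schwartz_real u -> schwartz_real u^`(n).
Proof.
by move=> su; elim: n => [//|n IHn]; rewrite derive1nS; exact: schwartz_derive1.
Qed.

Lemma schwartz_is_derive u (x : R) : schwartz_real u -> is_derive x 1 u (derive1 u x).
Proof.
by case=> du _; apply: DeriveDef; [exact: (du 0%N x)|rewrite derive1E].
Qed.

Lemma schwartz_continuous u : schwartz_real u -> continuous u.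
Proof.
by move=> su; apply: is_derive_continuous => x; exact: schwartz_is_derive.
Qed.

Lemma schwartz_measurable u : schwartz_real u -> measurable_fun setT u.
Proof. by move=> su; apply: continuous_measurable_fun; exact: schwartz_continuous. Qed.

Lemma schwartz_quadratic_decay u : schwartz_real u -> quadratic_decay u.
Proof.
case=> _ bu; have [M0 b0] := bu 0%N 0%N; have [M2 b2] := bu 2%N 0%N.
exists (M0 + M2) => x.
have x2 : 0 < 1 + x ^+ 2 by rewrite ltr_pwDl// sqr_ge0.
rewrite ler_pdivlMr// mulrDr mulr1 lerD//.
  by have := b0 x; rewrite derive1n0 expr0 mul1r.
by have := b2 x; rewrite derive1n0 normrM (ger0_norm (sqr_ge0 x)) mulrC.
Qed.

Lemma schwartz_integrable u : schwartz_real u -> mu.-integrable setT (EFin \o u).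
Proof.
move=> su; apply: integrable_quadratic_decay; first exact: schwartz_measurable.
exact: schwartz_quadratic_decay.
Qed.

Lemma quadratic_decay_cvgy f : quadratic_decay f -> f x @[x --> +oo] --> 0.
Proof.
case=> M fM; apply/cvgr0Pnorm_le => e e0.
near=> x.
rewrite (le_trans (fM x))// ler_pdivrMr; last by rewrite ltr_pwDl// sqr_ge0.
have x1 : 1 <= x by near: x; exact: nbhs_pinfty_ge.
have xM : M / e <= x by near: x; apply: nbhs_pinfty_ge; exact: num_real.
move: xM; rewrite ler_pdivrMr// => /le_trans; apply.
by rewrite mulrC ler_wpM2l ?ltW//; nra.
Unshelve. all: by end_near. Qed.

Lemma quadratic_decay_comp_oppr f : quadratic_decay f -> quadratic_decay (f \o -%R).
Proof. by case=> M fM; exists M => x /=; rewrite (le_trans (fM _))// sqrrN. Qed.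

Lemma quadratic_decay_cvgNy f : quadratic_decay f -> f x @[x --> -oo] --> 0.
Proof.
move=> df; apply/cvgNy_compNP.
exact: (quadratic_decay_cvgy (quadratic_decay_comp_oppr df)).
Qed.

Lemma quadratic_decayM f g C : quadratic_decay f -> (forall x, `|g x| <= C) ->
  quadratic_decay (fun x => f x * g x).
Proof.
case=> M fM gC; exists (M * C) => x.
by rewrite normrM mulrAC ler_pM.
Qed.

(** The derivative of [u * h] is integrable and [u * h] vanishes at both
    infinities, so there are no boundary terms. *)
Lemma Rintegral_parts u (h h' : R -> R) (C : R) : schwartz_real u ->
  (forall x : R, is_derive x 1 h (h' x)) -> continuous h' ->
  (forall x, `|h x| <= C) -> (forall x, `|h' x| <= C) ->
  \int[mu]_x (u x * h' x) = - \int[mu]_x (derive1 u x * h x).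
Proof.
move=> su dh ch' hC h'C.
have ch := is_derive_continuous dh.
have su' := schwartz_derive1 su.
have mh : measurable_fun setT h by exact: continuous_measurable_fun.
have mh' : measurable_fun setT h' by exact: continuous_measurable_fun.
have i1 := integrable_bounded_mul (schwartz_integrable su) mh' h'C.
have i2 := integrable_bounded_mul (schwartz_integrable su') mh hC.
apply/eqP; rewrite -addr_eq0 -RintegralD//; apply/eqP.
rewrite -[RHS]subr0; apply: (@FTC2T _ _ (fun x => u x * h x)).
- exact: (integrableD measurableT i1 i2).
- by move=> x; apply: cvgD; apply: cvgM; [exact: schwartz_continuous|exact: ch'|
    exact: (schwartz_continuous su')|exact: ch].
- move=> x; have := schwartz_is_derive x su => dx.
  apply: (is_derive_eq (is_deriveM dx (dh x))).
  by rewrite /GRing.scale/= (mulrC (h x)).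
- exact/quadratic_decay_cvgNy/(quadratic_decayM (schwartz_quadratic_decay su) hC).
- exact/quadratic_decay_cvgy/(quadratic_decayM (schwartz_quadratic_decay su) hC).
Qed.

End Schwartz.

(** * The cosine transform with a phase *)

Section CosTransform.
Local Open Scope classical_set_scope.
Variable R : realType.
Notation mu := (@lebesgue_measure R).
Implicit Types (f g F u : R -> R) (D : set R) (k t x : R).

Lemma is_derive_affine (k t x : R) : is_derive x 1 (fun x : R => k * x + t) k.
Proof.
apply: (is_derive_eq (is_deriveD (is_deriveZ k (is_derive_id x 1))
  (is_derive_cst t x 1))).
by rewrite addr0 /GRing.scale/= mulr1.
Qed.

Lemma is_derive_cos_affine (k t x : R) :
  is_derive x 1 (fun x : R => cos (k * x + t)) (- k * sin (k * x + t)).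
Proof.
have := is_derive_affine k t x => d.
by apply: (is_derive_eq (is_derive1_comp (is_derive_cos _) d)); ring.
Qed.

Lemma is_derive_sin_affine (k t x : R) :
  is_derive x 1 (fun x : R => sin (k * x + t)) (k * cos (k * x + t)).
Proof.
have := is_derive_affine k t x => d.
by apply: (is_derive_eq (is_derive1_comp (is_derive_sin _) d)); ring.
Qed.

Lemma continuous_cos_affine k t : continuous (fun x : R => cos (k * x + t)).
Proof. by apply: is_derive_continuous => x; exact: is_derive_cos_affine. Qed.

Lemma norm_cos_le1 x : `|cos x| <= 1.
Proof. by rewrite ler_norml cos_geN1 cos_le1. Qed.

Lemma norm_sin_le1 x : `|sin x| <= 1.
Proof. by rewrite ler_norml sin_geN1 sin_le1. Qed.

Definition cos_transform u k t : R := \int[mu]_x (u x * cos (k * x + t)).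

Lemma integrable_mul_cos u k t : mu.-integrable setT (EFin \o u) ->
  mu.-integrable setT (EFin \o (fun x => u x * cos (k * x + t))).
Proof.
move=> iu; apply: (integrable_bounded_mul (C := 1)) => //.
  by apply: continuous_measurable_fun; exact: continuous_cos_affine.
by move=> x; exact: norm_cos_le1.
Qed.

(** Differentiating [u] multiplies the transform by [k] and advances the phase by
    a quarter turn, because sine is a cosine shifted by [pi / 2].  The family over
    all phases is thus closed under integration by parts. *)
Lemma cos_transform_derive1 u k t : schwartz_real u ->
  cos_transform (derive1 u) k (t + pi / 2) = k * cos_transform u k t.
Proof.
move=> su; rewrite /cos_transform -RintegralZl//; last first.
  exact: integrable_mul_cos (schwartz_integrable su).
under [RHS]eq_Rintegral do rewrite mulrCA.
rewrite (Rintegral_parts su (is_derive_sin_affine k t) (C := 1 + `|k|))//.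
- rewrite -[RHS]mulN1r -RintegralZl//.
  + by apply: eq_Rintegral => x _; rewrite addrA cosDpihalf; ring.
  + apply: (integrable_bounded_mul (C := 1)) => //.
    * exact/schwartz_integrable/schwartz_derive1.
    * apply: continuous_measurable_fun.
      exact: (is_derive_continuous (is_derive_sin_affine k t)).
    * by move=> x; exact: norm_sin_le1.
- by move=> x; apply: cvgM; [exact: cvg_cst|exact: continuous_cos_affine].
- by move=> x; rewrite (le_trans (norm_sin_le1 _))// lerDl.
- move=> x; rewrite normrM (@le_trans _ _ `|k|) ?lerDr//.
  by rewrite ler_piMr// norm_cos_le1.
Qed.

Lemma cos_transform_derive1n u k t n : schwartz_real u ->
  cos_transform (derive1n n u) k (t + n%:R * (pi / 2)) = k ^+ n * cos_transform u k t.
Proof.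
move=> su; elim: n => [|n IHn]; first by rewrite mul0r addr0 expr0 mul1r.
rewrite derive1nS exprS -mulrA -IHn -cos_transform_derive1; last exact: schwartz_derive1n.
by congr cos_transform; rewrite -natr1; ring.
Qed.

Lemma le_norm_cos_transform u k t : mu.-integrable setT (EFin \o u) ->
  `|cos_transform u k t| <= \int[mu]_x `|u x|.
Proof.
move=> iu; have ic := integrable_mul_cos k t iu.
apply: (le_trans (le_normr_Rintegral _ ic)) => //.
apply: le_Rintegral => //.
- exact: (integrable_norm ic).
- exact: (integrable_norm iu).
- by move=> x _; rewrite normrM ler_piMr// norm_cos_le1.
Qed.

(** The zeroth and fourth derivatives of [u] bound the transform and its product
    with [k ^+ 4]; the fourth power leaves room for a multiplier growing like
    [1 + `|k|] and an integrable [(1 + k ^+ 2)^-1]. *)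
Lemma cos_transform_decay u : schwartz_real u ->
  exists M, forall k t, `|cos_transform u k t| <= M / (1 + k ^+ 2) ^+ 2.
Proof.
move=> su; have iu := schwartz_integrable su.
have i4 := schwartz_integrable (schwartz_derive1n 4 su).
set I0 := \int[mu]_x `|u x|; set I4 := \int[mu]_x `|derive1n 4 u x|.
exists (2 * (I0 + I4)) => k t.
have k2 : 0 < 1 + k ^+ 2 by rewrite ltr_pwDl// sqr_ge0.
rewrite ler_pdivlMr ?exprn_gt0//.
have h0 := le_norm_cos_transform k t iu.
have := le_norm_cos_transform k (t + 4%:R * (pi / 2)) i4.
rewrite cos_transform_derive1n// normrM ger0_norm ?exprn_even_ge0// => h4.
rewrite (@le_trans _ _ (`|cos_transform u k t| * (2 * (1 + k ^+ 4))))//.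
  rewrite ler_wpM2l//.
  (* (1 + k^2)^2 <= 2 (1 + k^4), the difference being (k^2 - 1)^2 *)
  have := sqr_ge0 (k ^+ 2 - 1); rewrite -subr_ge0 => h.
  by rewrite (le_trans h)// le_eqVlt; apply/orP; left; apply/eqP; ring.
rewrite mulrCA ler_pM2l// mulrDr mulr1 lerD//.
by rewrite mulrC.
Qed.

Lemma continuous_cos_transform u t : mu.-integrable setT (EFin \o u) ->
  continuous (fun k => cos_transform u k t).
Proof.
move=> iu k.
have kI : k \in (`]k - 1, k + 1[ : set R).
  by rewrite inE/= in_itv/= ltrBlDr ltrDl ltr01.
apply: (@continuity_under_integral R _ _ mu
  (fun k x => u x * cos (k * x + t)) setT _ (k - 1) (k + 1)
  _ _ (fun x => `|u x|) _ _ k kI) => //.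
- by move=> l _; exact: integrable_mul_cos.
- apply: aeW => x _ l _; apply: cvgM; first exact: cvg_cst.
  under eq_fun do rewrite mulrC.
  by rewrite mulrC; exact: continuous_cos_affine.
- exact: (integrable_norm iu).
- move=> l _; apply: aeW => x _.
  by rewrite normrM ler_piMr// norm_cos_le1.
Qed.

(** Separating the phase gives joint control when [t] itself depends on [k], as in
    [measurable_cos_transform]. *)
Lemma cos_transform_phase u k t : mu.-integrable setT (EFin \o u) ->
  cos_transform u k t = cos_transform u k 0 * cos t + cos_transform u k (pi / 2) * sin t.
Proof.
move=> iu; rewrite /cos_transform -!RintegralZr//; [|exact: integrable_mul_cos..].
rewrite -RintegralD//; last 2 first.
- by apply: (@integrable_bounded_mul _ _ (fun=> cos t) 1);
    [exact: integrable_mul_cos|exact: measurable_cst|move=> _; exact: norm_cos_le1].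
- by apply: (@integrable_bounded_mul _ _ (fun=> sin t) 1);
    [exact: integrable_mul_cos|exact: measurable_cst|move=> _; exact: norm_sin_le1].
apply: eq_Rintegral => x _.
by rewrite addr0 cosDpihalf cosD; ring.
Qed.

Lemma measurable_cos_transform u (t : R -> R) : mu.-integrable setT (EFin \o u) ->
  measurable_fun setT t -> measurable_fun setT (fun k => cos_transform u k (t k)).
Proof.
move=> iu mt; under eq_fun do rewrite cos_transform_phase//.
have mo s : measurable_fun setT (fun k => cos_transform u k s).
  by apply: continuous_measurable_fun; exact: continuous_cos_transform.
apply: measurable_funD; apply: measurable_funM => //.
  apply: (measurableT_comp (f := @cos R)) => //.
  by apply: continuous_measurable_fun; exact: continuous_cos.
apply: (measurableT_comp (f := @sin R)) => //.
by apply: continuous_measurable_fun; exact: continuous_sin.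
Qed.

End CosTransform.

(** * The damping factor and its transform *)

Section Kernel.
Local Open Scope classical_set_scope.
Variable R : realType.
Notation mu := (@lebesgue_measure R).
Implicit Types (f g F u : R -> R) (D : set R) (k t x e y : R).

(** The factor of Abel summation: times a cosine, it has an elementary
    antiderivative on each half-line. *)
Definition damp e k : R := expR (- (e * `|k|)).

Lemma continuous_damp e : continuous (damp e).
Proof.
move=> x; apply: (@continuous_comp _ _ _ (fun k : R => - (e * `|k|)) expR).
  by apply: cvgN; apply: cvgM; [exact: cvg_cst|exact: norm_continuous].
exact: continuous_expR.
Qed.

Lemma quadratic_decay_damp e : 0 < e -> quadratic_decay (damp e).
Proof.
move=> e0; exists (1 + 4 / e ^+ 2) => x.
have x2 : 0 < 1 + x ^+ 2 by rewrite ltr_pwDl// sqr_ge0.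
rewrite ler_pdivlMr// ger0_norm ?expR_ge0// /damp expRN mulrC ler_pdivrMr ?expR_gt0//.
(* exp (2 s) >= (1 + s)^2 >= 1 + s^2 with s = e |x| / 2 *)
set s := e * `|x| / 2.
have s0 : 0 <= s by rewrite !mulr_ge0// ltW.
have -> : e * `|x| = s + s by rewrite /s; field.
have h : (1 + s) ^+ 2 <= expR (s + s).
  by rewrite expRD -expr2 lerXn2r ?nnegrE ?expR_ge0 ?addr_ge0// expR_ge1Dx.
apply: le_trans (ler_wpM2l _ h); last by rewrite addr_ge0// divr_ge0// sqr_ge0.
have h2 : 1 + s ^+ 2 <= (1 + s) ^+ 2 by nra.
apply: le_trans (ler_wpM2l _ h2); last by rewrite addr_ge0// divr_ge0// sqr_ge0.
have -> : s ^+ 2 = e ^+ 2 * x ^+ 2 / 4.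
  by rewrite /s !exprMn real_normK ?num_real// exprVn; congr (_ * _ / _); ring.
have -> : (1 + 4 / e ^+ 2) * (1 + e ^+ 2 * x ^+ 2 / 4) =
    1 + x ^+ 2 + (4 / e ^+ 2 + e ^+ 2 * x ^+ 2 / 4) by field; rewrite gt_eqF.
by rewrite lerDl; do ![exact: sqr_ge0 | exact: ler0n | apply: addr_ge0
                      | apply: divr_ge0 | apply: mulr_ge0].
Qed.

Lemma integrable_damp e : 0 < e -> mu.-integrable setT (EFin \o damp e).
Proof.
move=> e0; apply: integrable_quadratic_decay; last exact: quadratic_decay_damp.
by apply: continuous_measurable_fun; exact: continuous_damp.
Qed.

Lemma integrable_damp_cos e y t : 0 < e ->
  mu.-integrable setT (EFin \o (fun k => damp e k * cos (y * k + t))).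
Proof. by move=> e0; exact: integrable_mul_cos (integrable_damp e0). Qed.

(** An antiderivative of [expR (a * k) * cos (y * k + t)], used with [a = - e] on
    the right half-line and with [a = e] on the left one. *)
Let prim a y t k := expR (a * k) *
  ((y * sin (y * k + t) + a * cos (y * k + t)) / (a ^+ 2 + y ^+ 2)).

Let is_derive_prim a y t k : a != 0 ->
  is_derive k 1 (prim a y t) (expR (a * k) * cos (y * k + t)).
Proof.
move=> a0.
have d0 : a ^+ 2 + y ^+ 2 != 0.
  by rewrite gt_eqF// ltr_pwDl ?sqr_ge0// exprn_even_gt0.
have ds := is_derive_sin_affine y t k; have dc := is_derive_cos_affine y t k.
have da : is_derive k 1 (fun k : R => a * k) a.
  apply: (is_derive_eq (is_deriveZ a (is_derive_id k 1))).
  by rewrite /GRing.scale/= mulr1.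
have de := is_derive1_comp (is_derive_expR (a * k)) da.
have dn := is_deriveD (is_deriveZ y ds) (is_deriveZ a dc).
have dn' := is_deriveZ (a ^+ 2 + y ^+ 2)^-1 dn.
have dp := is_deriveM de dn'.
have -> : prim a y t = (expR \o (fun k => a * k)) *
  ((a ^+ 2 + y ^+ 2)^-1 \*:
    (y \*: (fun k => sin (y * k + t)) + a \*: (fun k => cos (y * k + t)))).
  by apply/funext => z; rewrite /prim [_ / _]mulrC.
apply: (is_derive_eq dp).
rewrite /GRing.scale/=.
rewrite -[X in _ + X * _ = _]/((a ^+ 2 + y ^+ 2)^-1 *
  (y * sin (y * k + t) + a * cos (y * k + t))).
by field.
Qed.

Let prim_bound a y t k : `|prim a y t k| <=
  expR (a * k) * ((`|y| + `|a|) / (a ^+ 2 + y ^+ 2)).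
Proof.
rewrite normrM ger0_norm ?expR_ge0// ler_wpM2l ?expR_ge0//.
rewrite normrM normfV (ger0_norm (addr_ge0 (sqr_ge0 a) (sqr_ge0 y))).
rewrite ler_wpM2r ?invr_ge0 ?addr_ge0 ?sqr_ge0//.
rewrite (le_trans (ler_normD _ _))// !normrM lerD//.
- by rewrite ler_piMr// norm_sin_le1.
- by rewrite ler_piMr// norm_cos_le1.
Qed.

Let prim_cvgy e y t : 0 < e -> prim (- e) y t k @[k --> +oo] --> 0.
Proof.
move=> e0; apply/norm_cvg0P.
set C := ((`|y| + `|- e|) / ((- e) ^+ 2 + y ^+ 2)).
have h : quadratic_decay (fun k => damp e k * C).
  exact: (quadratic_decayM (quadratic_decay_damp e0) (fun=> lexx `|C|)).
apply: (squeeze_cvgr _ _ (quadratic_decay_cvgy h)); last exact: cvg_cst.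
near=> k; rewrite normr_ge0/=.
have k0 : 0 <= k by near: k; apply: nbhs_pinfty_ge; exact: num_real.
by rewrite (le_trans (prim_bound _ _ _ _))// /damp (ger0_norm k0) mulNr.
Unshelve. all: by end_near. Qed.

Let prim_cvgNy e y t : 0 < e -> prim e y t k @[k --> -oo] --> 0.
Proof.
move=> e0; apply/norm_cvg0P.
set C := ((`|y| + `|e|) / (e ^+ 2 + y ^+ 2)).
have h : quadratic_decay (fun k => damp e k * C).
  exact: (quadratic_decayM (quadratic_decay_damp e0) (fun=> lexx `|C|)).
apply: (squeeze_cvgr _ _ (quadratic_decay_cvgNy h)); last exact: cvg_cst.
near=> k; rewrite normr_ge0/=.
have k0 : k <= 0 by near: k; apply: nbhs_ninfty_le; exact: num_real.
by rewrite (le_trans (prim_bound _ _ _ _))// /damp (ler0_norm k0) mulrN opprK.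
Unshelve. all: by end_near. Qed.

(** The two half-lines contribute the boundary values of the antiderivative at 0;
    the sine terms cancel, which is why the phase only enters through [cos t]. *)
Lemma integral_damp_cos e y t : 0 < e ->
  \int[mu]_k (damp e k * cos (y * k + t)) =
  cos t * (2 * e / (e ^+ 2 + y ^+ 2)).
Proof.
move=> e0; have ic := integrable_damp_cos y t e0.
have Ne0 : - e != 0 by rewrite oppr_eq0 gt_eqF.
have d0 : e ^+ 2 + y ^+ 2 != 0.
  by rewrite gt_eqF// ltr_pwDl ?sqr_ge0// exprn_gt0.
have cP a : continuous (fun k : R => expR (a * k) * cos (y * k + t)).
  move=> k; apply: cvgM; last exact: continuous_cos_affine.
  apply: (@continuous_comp _ _ _ (fun k : R => a * k) expR).
    by apply: cvgM; [exact: cvg_cst|exact: cvg_id].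
  exact: continuous_expR.
have E1 : {in `[(0 : R), +oo[%classic, (fun k => damp e k * cos (y * k + t)) =1
    (fun k => expR (- e * k) * cos (y * k + t))}.
  move=> k; rewrite inE/= in_itv/= andbT => k0.
  by rewrite /damp ger0_norm// mulNr.
have E2 : {in `]-oo, (0 : R)]%classic, (fun k => damp e k * cos (y * k + t)) =1
    (fun k => expR (e * k) * cos (y * k + t))}.
  move=> k; rewrite inE/= in_itv/= => k0.
  by rewrite /damp ler0_norm// mulrN opprK.
have i1 : mu.-integrable `[0%R, +oo[
    (EFin \o (fun k => expR (- e * k) * cos (y * k + t))).
  have : mu.-integrable `[0%R, +oo[ (EFin \o (fun k => damp e k * cos (y * k + t))).
    by apply: integrableS ic.
  by apply: eq_integrable => // k kI /=; rewrite E1.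
have i2 : mu.-integrable `]-oo, 0%R]
    (EFin \o (fun k => expR (e * k) * cos (y * k + t))).
  have : mu.-integrable `]-oo, 0%R] (EFin \o (fun k => damp e k * cos (y * k + t))).
    by apply: integrableS ic.
  by apply: eq_integrable => // k kI /=; rewrite E2.
have I1 := FTC2cy i1 (cP (- e)) (fun k => is_derive_prim y t k Ne0)
  (prim_cvgy y t e0).
have I2 := FTC2Nyc i2 (cP e) (fun k => is_derive_prim y t k (lt0r_neq0 e0))
  (prim_cvgNy y t e0).
rewrite (Rintegral_split 0)//.
transitivity (prim e y t 0 - 0 + (0 - prim (- e) y t 0)).
  by rewrite -I1 -I2; congr (_ + _); apply: eq_Rintegral.
by rewrite /prim !mulr0 expR0 !add0r sqrrN; field.
Qed.

End Kernel.

(** * Inversion for the cosine transform *)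

Section Inversion.
Local Open Scope classical_set_scope.
Variable R : realType.
Notation mu := (@lebesgue_measure R).
Implicit Types (f g F u : R -> R) (D : set R) (k t x e y : R).

Lemma EFin_Rintegral f : mu.-integrable setT (EFin \o f) ->
  (\int[mu]_x f x)%:E = (\int[mu]_x (f x)%:E)%E.
Proof. by move=> fi; rewrite /Rintegral fineK//; exact: integrable_fin_num. Qed.

(** Every section being integrable, [fine] loses nothing in the inner integrals;
    the bound by [C * h] gives absolute convergence on the product. *)
Lemma Rintegral_Fubini (f : R -> R -> R) (h : R -> R) C :
  measurable_fun setT (fun z : R * R => f z.1 z.2) ->
  mu.-integrable setT (EFin \o h) ->
  (forall x, mu.-integrable setT (EFin \o f x)) ->
  (forall y, mu.-integrable setT (EFin \o f ^~ y)) ->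
  (forall x, \int[mu]_y `|f x y| <= C * h x) ->
  \int[mu]_x \int[mu]_y f x y = \int[mu]_y \int[mu]_x f x y.
Proof.
move=> mf ih i1 i2 bf; rewrite /Rintegral; congr fine.
transitivity (\int[mu]_x \int[mu]_y (f x y)%:E)%E.
  by apply: eq_integral => x _; rewrite fineK//; apply: integrable_fin_num (i1 x).
transitivity (\int[mu]_y \int[mu]_x (f x y)%:E)%E; last first.
  apply: eq_integral => y _; rewrite fineK//.
  by apply: integrable_fin_num (i2 y).
have mF : measurable_fun setT (fun z : R * R => (f z.1 z.2)%:E).
  exact/measurable_EFinP.
apply: (@Fubini _ _ _ _ _ mu mu (fun z => (f z.1 z.2)%:E)).
apply/integrable12ltyP => //=.
apply: (@le_lt_trans _ _ (\int[mu]_x (C * h x)%:E)%E); last first.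
  have iCh : mu.-integrable setT (EFin \o (fun x => C * h x)).
    exact: (integrableZl measurableT C ih).
  by rewrite -EFin_Rintegral// ltry.
apply: ge0_le_integral => //=.
- by move=> x _; exact: integral_ge0.
- apply: (@measurable_fun_fubini_tonelli_F _ _ _ _ _ mu
    (fun z : R * R => `|(f z.1 z.2)%:E|%E)) => //.
  exact: measurableT_comp.
- apply/measurable_EFinP; apply: measurable_funM => //.
  by apply/measurable_EFinP; exact: measurable_int ih.
- move=> x _; rewrite -[leLHS]/(\int[mu]_y (`|f x y|)%:E)%E -EFin_Rintegral ?lee_fin//.
  exact: (integrable_norm (i1 x)).
Qed.

Lemma continuous_poisson e xi : 0 < e ->
  continuous (fun x : R => 2 * e / (e ^+ 2 + (x - xi) ^+ 2)).
Proof.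
move=> e0 x; apply: cvgM; first exact: cvg_cst.
apply: cvgV; first by rewrite gt_eqF// ltr_pwDl ?sqr_ge0// exprn_gt0.
apply: cvgD; first exact: cvg_cst.
apply: (@continuous_comp _ _ _ (fun x => x - xi) (fun x => x ^+ 2)).
  by apply: cvgB; [exact: cvg_id|exact: cvg_cst].
exact: exprn_continuous.
Qed.

Lemma poisson_le e xi x : 0 < e ->
  `|2 * e / (e ^+ 2 + (x - xi) ^+ 2)| <= 2 / e.
Proof.
move=> e0; have d0 : 0 < e ^+ 2 + (x - xi) ^+ 2.
  by rewrite ltr_pwDl ?sqr_ge0// exprn_gt0.
rewrite ger0_norm; last by rewrite divr_ge0 ?mulr_ge0// ltW.
rewrite ler_pdivrMr// mulrDr (_ : 2 / e * e ^+ 2 = 2 * e); last first.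
  by field; rewrite gt_eqF.
by rewrite lerDl mulr_ge0 ?sqr_ge0// divr_ge0// ltW.
Qed.

(** Exchanging the integrals turns the damped inversion integral into a Poisson
    integral of [u] at [xi]. *)
Lemma integral_damp_cos_transform u e xi t : schwartz_real u -> 0 < e ->
  \int[mu]_k (damp e k * cos_transform u k (t - k * xi)) =
  cos t * \int[mu]_x (u x * (2 * e / (e ^+ 2 + (x - xi) ^+ 2))).
Proof.
move=> su e0; have iu := schwartz_integrable su.
have id := integrable_damp e0.
pose f x k := u x * (damp e k * cos ((x - xi) * k + t)).
have fE x k : f x k = damp e k * (u x * cos (k * x + (t - k * xi))).
  by rewrite /f mulrCA; congr (_ * (_ * cos _)); ring.
have i1 x : mu.-integrable setT (EFin \o f x).
  exact: (integrableZl measurableT (u x) (integrable_damp_cos (x - xi) t e0)).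
have i2 k : mu.-integrable setT (EFin \o f ^~ k).
  apply: eq_integrable (integrableZl measurableT (damp e k)
    (integrable_mul_cos k (t - k * xi) iu)) => // x _ /=.
  by rewrite fE EFinM.
transitivity (\int[mu]_k \int[mu]_x f x k).
  apply: eq_Rintegral => k _; rewrite /cos_transform -RintegralZl//; last first.
    exact: integrable_mul_cos.
  by apply: eq_Rintegral => x _; rewrite fE.
rewrite -(@Rintegral_Fubini f (fun x => `|u x|) (\int[mu]_k damp e k))//; last 3 first.
- apply: measurable_funM.
    by apply: (measurableT_comp (f := u)) => //; exact: schwartz_measurable.
  apply: measurable_funM.
    apply: (measurableT_comp (f := damp e)) => //.
    by apply: continuous_measurable_fun; exact: continuous_damp.
  apply: (measurableT_comp (f := @cos R)).
    by apply: continuous_measurable_fun; exact: continuous_cos.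
  apply: measurable_funD => //; apply: measurable_funM => //.
  exact: measurable_funB.
- exact: (integrable_norm iu).
- move=> x; rewrite mulrC -RintegralZl//.
  apply: le_Rintegral => //.
  + exact: (integrable_norm (i1 x)).
  + exact: (integrableZl measurableT `|u x| id).
  + move=> k _; rewrite !normrM ler_wpM2l// ger0_norm ?expR_ge0//.
    by rewrite ler_piMr ?expR_ge0// norm_cos_le1.
have ik : mu.-integrable setT
    (EFin \o (fun x => u x * (2 * e / (e ^+ 2 + (x - xi) ^+ 2)))).
  apply: (integrable_bounded_mul (C := 2 / e)) => //; last first.
    by move=> x; exact: poisson_le.
  by apply: continuous_measurable_fun; exact: continuous_poisson.
rewrite -RintegralZl//; apply: eq_Rintegral => x _.
rewrite RintegralZl//; last exact: integrable_damp_cos.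
by rewrite integral_damp_cos// mulrCA.
Qed.

Lemma measurable_sgr : measurable_fun setT (@Num.sg R).
Proof.
rewrite (_ : @Num.sg R = fun x => if x == 0 then 0 else if x < 0 then -1 else 1)//.
apply: measurable_fun_ifT => //; first exact: measurable_fun_eqr.
by apply: measurable_fun_ifT => //; exact: measurable_fun_ltr.
Qed.

Lemma norm_atan_le (x : R) : `|atan x| <= pi / 2.
Proof. by rewrite ler_norml !ltW ?atan_gtNpi2 ?atan_ltpi2. Qed.

(** The Poisson kernel is the derivative of [2 * atan ((x - xi) / e)].  Moving the
    derivative to [u] replaces a concentrating kernel by a bounded step-like
    function, so that dominated convergence applies as [e] tends to 0. *)
Lemma integral_poisson u e xi : schwartz_real u -> 0 < e ->
  \int[mu]_x (u x * (2 * e / (e ^+ 2 + (x - xi) ^+ 2))) =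
  - \int[mu]_x (derive1 u x * (2 * atan (e^-1 * x + - (e^-1 * xi)))).
Proof.
move=> su e0; have ne0 : e != 0 by rewrite gt_eqF.
have da x : is_derive x 1 (fun x : R => 2 * atan (e^-1 * x + - (e^-1 * xi)))
    (2 * e / (e ^+ 2 + (x - xi) ^+ 2)).
  have d := is_derive_affine e^-1 (- (e^-1 * xi)) x.
  have dd := is_deriveZ 2 (is_derive1_comp (is_derive1_atan _) d).
  have h1 : e ^+ 2 + (x - xi) ^+ 2 != 0.
    by rewrite gt_eqF// ltr_pwDl ?sqr_ge0// exprn_gt0.
  apply: (is_derive_eq dd); rewrite /GRing.scale/=.
  have -> : 1 + (e^-1 * x - e^-1 * xi) ^+ 2 = (e ^+ 2 + (x - xi) ^+ 2) / e ^+ 2.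
    by field.
  by field; rewrite h1 ne0.
apply: (Rintegral_parts su da (C := pi + 2 / e)).
- exact: continuous_poisson.
- move=> x; rewrite normrM ger0_norm// (@le_trans _ _ pi)//.
    by rewrite mulrC -ler_pdivlMr// norm_atan_le.
  by rewrite lerDl divr_ge0// ltW.
- by move=> x; rewrite (le_trans (poisson_le _ _ e0))// lerDr pi_ge0.
Qed.

Lemma integrable_mul_sgr u xi : mu.-integrable setT (EFin \o u) ->
  mu.-integrable setT (EFin \o (fun x => u x * Num.sg (x - xi))).
Proof.
move=> iu; apply: (integrable_bounded_mul (C := 1)) => //.
  by apply: (measurableT_comp measurable_sgr); exact: measurable_funB.
by move=> x; rewrite normr_sg; case: eqP.
Qed.

(** The fundamental theorem on each side of [xi]: each half-line gives [- u xi]. *)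
Lemma integral_sgr_derive1 u xi : schwartz_real u ->
  \int[mu]_x (derive1 u x * Num.sg (x - xi)) = - 2 * u xi.
Proof.
move=> su; have su' := schwartz_derive1 su.
have i' := schwartz_integrable su'.
have isg := integrable_mul_sgr xi i'.
have sc := schwartz_continuous su'; have du x := schwartz_is_derive x su.
have duf := schwartz_quadratic_decay su.
rewrite (Rintegral_split xi)// -(Rintegral_itv_bndo_bndc (r := xi)); last first.
  by apply: integrableS isg.
rewrite -(Rintegral_itv_obnd_cbnd (r := xi)); last first.
  by apply: integrableS isg.
transitivity (\int[mu]_(x in `]-oo, xi[) (derive1 u x * -1) +
              \int[mu]_(x in `]xi, +oo[) derive1 u x).
  congr (_ + _); apply: eq_Rintegral => x; rewrite inE/= in_itv/= ?andbT => xxi.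
    by rewrite ltr0_sg// subr_lt0.
  by rewrite gtr0_sg ?subr_gt0// mulr1.
rewrite RintegralZr//; last by apply: integrableS i'.
rewrite Rintegral_itv_bndo_bndc; last by apply: integrableS i'.
rewrite Rintegral_itv_obnd_cbnd; last by apply: integrableS i'.
rewrite (FTC2Nyc _ sc du (quadratic_decay_cvgNy duf)); last by apply: integrableS i'.
rewrite (FTC2cy _ sc du (quadratic_decay_cvgy duf)); last by apply: integrableS i'.
ring.
Qed.

Lemma cvg_atan_sgr (y : R) :
  2 * atan (n.+1%:R * y) @[n --> \oo] --> pi * Num.sg y.
Proof.
have pos (z : R) : 0 < z -> 2 * atan (n.+1%:R * z) @[n --> \oo] --> (pi : R).
  move=> z0; rewrite [X in _ --> X](_ : _ = 2 * (pi / 2)); last by field.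
  apply: cvgM; first exact: cvg_cst.
  apply: (cvg_comp _ _ _ (@cvgy_atan R)).
  apply/cvgryPge => A; near=> n.
  rewrite -ler_pdivrMr// (@le_trans _ _ n%:R)//; last by rewrite ler_nat.
  near: n; exact: nbhs_infty_ger.
have [y0|y0|->] := ltgtP y 0.
- rewrite ltr0_sg// mulrN1.
  rewrite (_ : (fun n : nat => _) = (fun n => - (2 * atan (n.+1%:R * - y)))); last first.
    by apply/funext => n; rewrite mulrN atanN mulrN opprK.
  by apply: cvgN; apply: pos; rewrite oppr_gt0.
- by rewrite gtr0_sg// mulr1; exact: pos.
- rewrite sgr0 mulr0; under eq_fun do rewrite mulr0 atan0 mulr0.
  exact: cvg_cst.
Unshelve. all: by end_near. Qed.

(** Both sides of the identity of [integral_damp_cos_transform] converge along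
    [e = 1 / (n + 1)]: the left one, dominated by the transform itself, to the
    undamped integral, and the right one through [integral_poisson] to a multiple
    of the integral of [integral_sgr_derive1]. *)
Theorem cos_transform_inversion u xi t : schwartz_real u ->
  \int[mu]_k cos_transform u k (t - k * xi) = 2 * pi * u xi * cos t.
Proof.
move=> su; have su' := schwartz_derive1 su; have iu := schwartz_integrable su.
pose e (n : nat) : R := n.+1%:R^-1.
have e0 n : 0 < e n by rewrite invr_gt0.
have mo : measurable_fun setT (fun k => cos_transform u k (t - k * xi)).
  apply: measurable_cos_transform => //.
  by apply: measurable_funB => //; exact: measurable_funM.
have io : mu.-integrable setT (EFin \o (fun k => cos_transform u k (t - k * xi))).
  apply: integrable_quadratic_decay => //.
  have [M hM] := cos_transform_decay su; exists `|M| => k.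
  have k1 : 1 <= 1 + k ^+ 2 by rewrite lerDl sqr_ge0.
  have k0 : 0 < 1 + k ^+ 2 by exact: lt_le_trans ltr01 k1.
  rewrite (le_trans (hM _ _))// ler_pdivrMr ?exprn_gt0// (le_trans (ler_norm M))//.
  by rewrite expr2 mulrA divfK ?gt_eqF// ler_peMr.
have L : \int[mu]_k (damp (e n) k * cos_transform u k (t - k * xi)) @[n --> \oo] -->
    \int[mu]_k cos_transform u k (t - k * xi).
  apply: (Rdominated_cvg (g := fun k => `|cos_transform u k (t - k * xi)|)) => //.
  - move=> n; apply: measurable_funM => //.
    by apply: continuous_measurable_fun; exact: continuous_damp.
  - move=> k _; rewrite -[X in _ --> X]mul1r; apply: cvgM; last exact: cvg_cst.
    rewrite /damp -[X in _ --> X](@expR0 R).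
    have h : - (e n * `|k|) @[n --> \oo] --> (0 : R).
      rewrite -[X in _ --> X]oppr0 -[X in _ --> - X](mul0r `|k|); apply: cvgN.
      by apply: cvgM; [exact: cvg_harmonic|exact: cvg_cst].
    exact: (cvg_comp _ _ h (@continuous_expR R 0)).
  - exact: (integrable_norm io).
  - move=> n k _; rewrite normrM ger0_norm ?expR_ge0// ler_piMl//.
    by rewrite -expR0 ler_expR oppr_le0 mulr_ge0// ltW.
have iu' := schwartz_integrable su'.
have L2 :
    \int[mu]_x (derive1 u x * (2 * atan ((e n)^-1 * x + - ((e n)^-1 * xi))))
    @[n --> \oo] --> \int[mu]_x (derive1 u x * (pi * Num.sg (x - xi))).
  apply: (Rdominated_cvg (g := fun x => `|derive1 u x| * pi)) => //.
  - move=> n; apply: measurable_funM; first exact: schwartz_measurable.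
    apply: measurable_funM => //.
    apply: continuous_measurable_fun.
    have d x := is_derive1_comp (is_derive1_atan _)
      (is_derive_affine (e n)^-1 (- ((e n)^-1 * xi)) x).
    exact: (is_derive_continuous d).
  - apply: measurable_funM; first exact: schwartz_measurable.
    apply: measurable_funM => //.
    by apply: (measurableT_comp measurable_sgr); exact: measurable_funB.
  - move=> x _; apply: cvgM; first exact: cvg_cst.
    under eq_fun do rewrite /e invrK -mulrBr.
    exact: cvg_atan_sgr.
  - exact: (integrableZr measurableT pi (integrable_norm iu')).
  - move=> n x _; rewrite normrM ler_wpM2l// normrM ger0_norm//.
    by rewrite mulrC -ler_pdivlMr// norm_atan_le.
apply: (cvg_unique _ L) => /=; first exact: Rhausdorff.
under eq_fun do rewrite integral_damp_cos_transform// integral_poisson//.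
rewrite (_ : 2 * pi * u xi * cos t =
    cos t * - (\int[mu]_x (derive1 u x * (pi * Num.sg (x - xi))))).
  by apply: cvgM; [exact: cvg_cst|exact: cvgN].
under eq_Rintegral do rewrite mulrCA.
rewrite RintegralZl//; last exact: integrable_mul_sgr.
by rewrite integral_sgr_derive1//; ring.
Qed.

End Inversion.

(** * Exponentials *)

Section Exponentials.
Local Open Scope classical_set_scope.
Variable R : realType.
Implicit Types (z w k d : R[i]) (x : R).

Lemma cexpD z w : cexp (z + w) = cexp z * cexp w.
Proof.
case: z w => [a b] [c d]; rewrite /cexp /= expRD cosD sinD.
by apply/eqP; rewrite eq_complex /=; apply/andP; split; apply/eqP; ring.
Qed.

Lemma sqr_cexp z : complex.Re (cexp z) ^+ 2 + complex.Im (cexp z) ^+ 2 =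
  expR (complex.Re z) ^+ 2.
Proof. by rewrite /= !exprMn -mulrDr cos2Dsin2 mulr1. Qed.

Lemma cexp_neq0 z : cexp z != 0.
Proof.
apply/eqP => z0; have := sqr_cexp z; rewrite z0 /= expr0n /= addr0 => /esym/eqP.
by rewrite expf_eq0/= gt_eqF ?expR_gt0.
Qed.

Lemma Re_affine k d x :
  complex.Re (k * x%:C + d) = complex.Re k * x + complex.Re d.
Proof. by case: k d => [a b] [c e] /=; rewrite mulr0 subr0. Qed.

(** The modulus forces the real part of [k] to vanish; if the imaginary part [b]
    did not, the value at [pi / b] would be [-1]. *)
Lemma cexp_line_const k d : (forall x, cexp (k * x%:C + d) = 1) -> k = 0.
Proof.
move=> h.
have h0 x : cexp (k * x%:C) = 1.
  have := h 0; rewrite mulr0 add0r => d1.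
  by have := h x; rewrite cexpD d1 mulr1.
case: k {h} h0 => a b h0.
have a0 : a = 0.
  have := sqr_cexp ((a +i* b) * 1%:C); rewrite h0 /= expr0n addr0 expr1n.
  rewrite mulr1 mulr0 subr0 => /esym/eqP.
  rewrite sqrf_eq1 => /orP[/eqP|/eqP e1]; last first.
    by have := expR_ge0 a; rewrite e1 ler0N1.
  by rewrite -expR0 => /expR_inj.
have [->|b0] := eqVneq b 0; first by rewrite a0.
have /(congr1 (@complex.Re R)) := h0 (pi / b).
rewrite /cexp /= a0 !mul0r mulr0 sub0r oppr0 expR0 mul1r add0r.
rewrite mulrC divfK// cospi => /eqP.
by rewrite -subr_eq0 -opprD oppr_eq0 -mulr2n pnatr_eq0.
Qed.

Lemma expfun_rate_inj k k' d d' : expfun k d = expfun k' d' -> k = k'.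
Proof.
move=> e; apply/eqP; rewrite -subr_eq0; apply/eqP.
apply: (@cexp_line_const _ (d - d')) => x.
have := congr1 (fun f => f x) e; rewrite /expfun.
rewrite (_ : k * x%:C + d =
  ((k - k') * x%:C + (d - d')) + (k' * x%:C + d')); last by ring.
by rewrite cexpD -[RHS]mul1r => /(mulIf (cexp_neq0 _)).
Qed.

Lemma fracD_expfun (alpha : R) k d x :
  fracD alpha (expfun k d) x = cpow k alpha * expfun k d x.
Proof.
rewrite /fracD; case: asboolP => [_|[]]; last by exists k, d.
rewrite (_ : xget 0 (exp_rates (expfun k d)) = k)//.
by apply: xget_unique => [|k' [d' /esym/expfun_rate_inj//]]; exists d.
Qed.

Lemma hirota_expfun (alpha : R) k1 k2 d1 d2 x :
  hirota alpha (expfun k1 d1) (expfun k2 d2) x =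
  (cpow k1 alpha - cpow k2 alpha) * cexp ((k1 * x%:C + d1) + (k2 * x%:C + d2)).
Proof. by rewrite /hirota !fracD_expfun cexpD /expfun; ring. Qed.

(** In the direction where its modulus does not decrease, an exponential violates
    the boundedness of [x * f x]. *)
Lemma schwartz_not_expfun f k : schwartz f -> ~ exp_rates f k.
Proof.
move=> [[_ bu] [_ bv]] [d fE].
have [M1 h1] := bu 1%N 0%N; have [M2 h2] := bv 1%N 0%N.
pose B := M1 ^+ 2 + M2 ^+ 2; pose K := expR (complex.Re d) ^+ 2.
have K0 : 0 < K by rewrite exprn_gt0// expR_gt0.
have B0 : 0 <= B by rewrite addr_ge0// sqr_ge0.
have sq (M z : R) : `|z| <= M -> z ^+ 2 <= M ^+ 2.
  by move=> zM; rewrite -[leLHS]real_normK ?num_real// lerXn2r ?nnegrE// (le_trans _ zM).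
have bd x : 0 <= complex.Re k * x -> x ^+ 2 * K <= B.
  move=> kx.
  have b1 := sq _ _ (h1 x); have b2 := sq _ _ (h2 x).
  apply: le_trans (lerD b1 b2); rewrite !derive1n0 expr1 !exprMn -mulrDr.
  rewrite ler_wpM2l ?sqr_ge0// fE /expfun sqr_cexp lerXn2r ?nnegrE ?expR_ge0//.
  by rewrite ler_expR Re_affine lerDr.
(* y >= 1 and y > B / K, hence y^2 K > B *)
pose y := B / K + 1.
have y1 : 1 <= y by rewrite lerDr divr_ge0// ltW.
have y2 : B < y ^+ 2 * K.
  rewrite -ltr_pdivrMr// (@lt_le_trans _ _ y)// ?ltrDl//.
  by rewrite expr2 ler_peMr// (le_trans ler01).
have [k0|k0] := leP 0 (complex.Re k).
  by have := bd y (mulr_ge0 k0 (le_trans ler01 y1)); rewrite leNgt y2.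
have k1 : 0 <= complex.Re k * - y.
  by rewrite mulrN -mulNr mulr_ge0// ?oppr_ge0 ?ltW// (lt_le_trans ltr01).
by have := bd _ k1; rewrite sqrrN leNgt y2.
Qed.

Lemma fracD_schwartz (alpha : R) f : schwartz f ->
  fracD alpha f = inv_fourier (fun k : R => cpow (k*i) alpha * fourier f k).
Proof.
move=> sf; rewrite /fracD; case: asboolP => // -[k].
by move/(schwartz_not_expfun sf).
Qed.

End Exponentials.

(** * Integrals of complex-valued functions *)

Section ComplexIntegral.
Local Open Scope classical_set_scope.
Variable R : realType.
Notation mu := (@lebesgue_measure R).
Implicit Types (f g : R -> R[i]).

Lemma complex_eqP (z w : R[i]) : complex.Re z = complex.Re w ->
  complex.Im z = complex.Im w -> z = w.
Proof. by case: z w => [a b] [c d] /= -> ->. Qed.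

Lemma ReM (z w : R[i]) : complex.Re (z * w) =
  complex.Re z * complex.Re w - complex.Im z * complex.Im w.
Proof. by case: z w => [a b] [c d]. Qed.

Lemma ImM (z w : R[i]) : complex.Im (z * w) =
  complex.Re z * complex.Im w + complex.Im z * complex.Re w.
Proof. by case: z w => [a b] [c d]. Qed.

Lemma ReB (z w : R[i]) : complex.Re (z - w) = complex.Re z - complex.Re w.
Proof. by case: z w => [a b] [c d]. Qed.

Lemma ImB (z w : R[i]) : complex.Im (z - w) = complex.Im z - complex.Im w.
Proof. by case: z w => [a b] [c d]. Qed.

Definition Cintegrable f :=
  mu.-integrable setT (EFin \o (fun x => complex.Re (f x))) /\
  mu.-integrable setT (EFin \o (fun x => complex.Im (f x))).

Lemma Cintegrable_ext f g : f =1 g -> Cintegrable f -> Cintegrable g.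
Proof. by move=> /funext ->. Qed.

Lemma eq_Cintegral f g : f =1 g -> Cintegral f = Cintegral g.
Proof. by move=> /funext ->. Qed.

Lemma integrable_scale (c : R) (u : R -> R) : mu.-integrable setT (EFin \o u) ->
  mu.-integrable setT (EFin \o (fun x => c * u x)).
Proof. by move=> iu; exact: (integrableZl measurableT c iu). Qed.

Lemma CintegrableZl (c : R[i]) f : Cintegrable f -> Cintegrable (fun x => c * f x).
Proof.
case=> fr fi; split; rewrite /comp.
  under eq_fun do rewrite ReM EFinB.
  by apply: integrableB => //; exact: integrable_scale.
under eq_fun do rewrite ImM EFinD.
by apply: integrableD => //; exact: integrable_scale.
Qed.

Lemma CintegralZl (c : R[i]) f : Cintegrable f ->
  Cintegral (fun x => c * f x) = c * Cintegral f.
Proof.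
case=> fr fi; apply: complex_eqP.
  rewrite ReM /= -!RintegralZl// -RintegralB//; [|exact: integrable_scale..].
  by apply: eq_Rintegral => x _; rewrite ReM.
rewrite ImM /= -!RintegralZl// -RintegralD//; [|exact: integrable_scale..].
by apply: eq_Rintegral => x _; rewrite ImM.
Qed.

Lemma CintegralB f g : Cintegrable f -> Cintegrable g ->
  Cintegral (fun x => f x - g x) = Cintegral f - Cintegral g.
Proof.
case=> fr fi [gr gi]; apply: complex_eqP.
  rewrite ReB /= -RintegralB//; apply: eq_Rintegral => x _; exact: ReB.
rewrite ImB /= -RintegralB//; apply: eq_Rintegral => x _; exact: ImB.
Qed.

End ComplexIntegral.

(** * The multiplier (ik)^alpha *)

Section Multiplier.
Local Open Scope classical_set_scope.
Variable R : realType.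
Notation mu := (@lebesgue_measure R).
Implicit Types (k xi : R).
Variable alpha : R.
Hypotheses (alpha_ge0 : 0 <= alpha) (alpha_le1 : alpha <= 1).

Let arg k := alpha * (if 0 <= k then acos 0 else - acos 0).

(** The argument of [ik] takes one value on each half-line, [acos 0 = pi / 2] or
    its opposite, so it is measurable in [k]. *)
Lemma cpow_imE k : cpow (k*i) alpha = if k == 0 then 0 else
  (expR (alpha * ln `|k|) * cos (arg k)) +i* (expR (alpha * ln `|k|) * sin (arg k)).
Proof.
rewrite /cpow eq_complex /= eqxx /=; case: ifP => // _.
rewrite /cexp /clog /carg /= !mul0r subr0 addr0 expr0n/= add0r sqrtr_sqr.
by [].
Qed.

Let arg_measurable : measurable_fun setT arg.
Proof.
apply: measurable_funM => //; apply: measurable_fun_ifT => //.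
exact: measurable_fun_ler.
Qed.

Let modulus_measurable : measurable_fun setT (fun k : R => expR (alpha * ln `|k|)).
Proof.
apply: (measurableT_comp (@measurable_expR R)); apply: measurable_funM => //.
by apply: (measurableT_comp (@measurable_ln R)); exact: normr_measurable.
Qed.

(** Both factors of [alpha * ln `|k|] are bounded: [ln `|k|] by the nonnegative
    number [ln (1 + `|k|)] and [alpha] by 1. *)
Let modulus_le k : k != 0 -> expR (alpha * ln `|k|) <= 1 + `|k|.
Proof.
move=> k0; have k1 : 0 < `|k| by rewrite normr_gt0.
have k2 : 0 < 1 + `|k| by rewrite ltr_pwDl.
rewrite -[leRHS]lnK ?posrE// ler_expR (@le_trans _ _ (alpha * ln (1 + `|k|)))//.
  by rewrite ler_wpM2l// ler_ln ?posrE// lerDr.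
by rewrite ler_piMl// ln_ge0// lerDl.
Qed.

Lemma measurable_Re_cpow_im :
  measurable_fun setT (fun k : R => complex.Re (cpow (k*i) alpha)).
Proof.
under eq_fun do rewrite cpow_imE (fun_if (@complex.Re R)) /=.
apply: measurable_fun_ifT => //; first exact: measurable_fun_eqr.
apply: measurable_funM => //; apply: (measurableT_comp (f := @cos R)) => //.
by apply: continuous_measurable_fun; exact: continuous_cos.
Qed.

Lemma measurable_Im_cpow_im :
  measurable_fun setT (fun k : R => complex.Im (cpow (k*i) alpha)).
Proof.
under eq_fun do rewrite cpow_imE (fun_if (@complex.Im R)) /=.
apply: measurable_fun_ifT => //; first exact: measurable_fun_eqr.
apply: measurable_funM => //; apply: (measurableT_comp (f := @sin R)) => //.
by apply: continuous_measurable_fun; exact: continuous_sin.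
Qed.

Lemma Re_cpow_im_le k : `|complex.Re (cpow (k*i) alpha)| <= 1 + `|k|.
Proof.
rewrite cpow_imE; case: eqVneq => [->|k0] /=; first by rewrite !normr0 addr0.
rewrite normrM ger0_norm ?expR_ge0// (le_trans _ (modulus_le k0))//.
by rewrite ler_piMr ?expR_ge0// norm_cos_le1.
Qed.

Lemma Im_cpow_im_le k : `|complex.Im (cpow (k*i) alpha)| <= 1 + `|k|.
Proof.
rewrite cpow_imE; case: eqVneq => [->|k0] /=; first by rewrite !normr0 addr0.
rewrite normrM ger0_norm ?expR_ge0// (le_trans _ (modulus_le k0))//.
by rewrite ler_piMr ?expR_ge0// norm_sin_le1.
Qed.

End Multiplier.

(** * Fourier inversion for Schwartz functions *)

Section Fourier.
Local Open Scope classical_set_scope.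
Variable R : realType.
Notation mu := (@lebesgue_measure R).
Implicit Types (k xi : R) (f g : R -> R[i]).

Definition quartic_decay (p : R -> R) :=
  exists M, forall k, `|p k| <= M / (1 + k ^+ 2) ^+ 2.

Lemma quartic_decayD p q : quartic_decay p -> quartic_decay q ->
  quartic_decay (fun k => p k + q k).
Proof.
move=> [M hM] [N hN]; exists (M + N) => k.
by rewrite mulrDl (le_trans (ler_normD _ _))// lerD.
Qed.

Lemma quartic_decayN p : quartic_decay p -> quartic_decay (fun k => - p k).
Proof. by move=> [M hM]; exists M => k; rewrite normrN. Qed.

Lemma integrable_mul_quartic_decay (p q : R -> R) : measurable_fun setT p ->
  measurable_fun setT q -> (forall k, `|p k| <= 1 + `|k|) -> quartic_decay q ->
  mu.-integrable setT (EFin \o (fun k => p k * q k)).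
Proof.
move=> mp mq hp [M hM]; apply: integrable_quadratic_decay; first exact: measurable_funM.
exists (2 * M) => k.
have k0 : 0 < 1 + k ^+ 2 by rewrite ltr_pwDl ?sqr_ge0.
have hk : `|p k| <= 2 * (1 + k ^+ 2).
  apply: (le_trans (hp k)).
  have := sqr_ge0 (`|k| - 1); have := real_normK (num_real k).
  by move: `|k| => r <-; nra.
rewrite normrM; apply: (le_trans (ler_pM _ _ hk (hM k))) => //.
by rewrite le_eqVlt; apply/orP; left; apply/eqP; field; rewrite gt_eqF.
Qed.

(** The quantitative form of rapid decay used here: with the factor [1 + `|k|] of
    the multiplier the product is still integrable
    ([Cintegrable_mul_rapid]). *)
Definition rapid f := [/\ measurable_fun setT (fun k => complex.Re (f k)),
  measurable_fun setT (fun k => complex.Im (f k)),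
  quartic_decay (fun k => complex.Re (f k)) & quartic_decay (fun k => complex.Im (f k))].

Lemma Cintegrable_mul_rapid (m f : R -> R[i]) :
  measurable_fun setT (fun k => complex.Re (m k)) ->
  measurable_fun setT (fun k => complex.Im (m k)) ->
  (forall k, `|complex.Re (m k)| <= 1 + `|k|) ->
  (forall k, `|complex.Im (m k)| <= 1 + `|k|) ->
  rapid f -> Cintegrable (fun k => m k * f k).
Proof.
move=> mr mi br bi [fr fi dr di]; split; rewrite /comp.
  under eq_fun do rewrite ReM EFinB.
  by apply: integrableB => //; exact: integrable_mul_quartic_decay.
under eq_fun do rewrite ImM EFinD.
by apply: integrableD => //; exact: integrable_mul_quartic_decay.
Qed.

Variables (f : R -> R[i]) (xi : R).
Hypothesis sf : schwartz f.
Let u x := complex.Re (f x).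
Let v x := complex.Im (f x).
Let su : schwartz_real u := sf.1.
Let sv : schwartz_real v := sf.2.

Let wave k := fourier f k * cexp ((k * xi)*i).

Let iu := schwartz_integrable su.
Let iv := schwartz_integrable sv.

Lemma cexp_im (t : R) : cexp (t*i) = cos t +i* sin t.
Proof. by rewrite /cexp /= expR0 !mul1r. Qed.

Let fourierE k : fourier f k =
  (cos_transform u k 0 - cos_transform v k (pi / 2)) +i*
  (cos_transform v k 0 + cos_transform u k (pi / 2)).
Proof.
have E x : cexp (- (k * x)*i) = cos (k * x) -i* sin (k * x).
  by rewrite /cexp /= oppr0 expR0 !mul1r cosN sinN.
apply: complex_eqP => /=.
  rewrite -RintegralB//; [|exact: integrable_mul_cos..].
  by apply: eq_Rintegral => x _; rewrite E ReM /= addr0 cosDpihalf.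
rewrite -RintegralD//; [|exact: integrable_mul_cos..].
apply: eq_Rintegral => x _; rewrite E ImM /= addr0 cosDpihalf.
by rewrite addrC.
Qed.

(** The modulation by [e^{ik xi}] is absorbed by the phase. *)
Let waveE k : wave k =
  (cos_transform u k (0 - k * xi) - cos_transform v k (pi / 2 - k * xi)) +i*
  (cos_transform v k (0 - k * xi) + cos_transform u k (pi / 2 - k * xi)).
Proof.
rewrite /wave fourierE cexp_im.
rewrite !(cos_transform_phase _ (_ - k * xi))//.
rewrite sub0r !cosN !sinN cosB sinB cos_pihalf sin_pihalf.
by apply: complex_eqP; rewrite ?ReM ?ImM /=; ring.
Qed.

Let quartic (w : R -> R) t : schwartz_real w ->
  quartic_decay (fun k => cos_transform w k (t - k * xi)).
Proof. by move=> /cos_transform_decay[M hM]; exists M. Qed.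

Let meas (w : R -> R) t : schwartz_real w ->
  measurable_fun setT (fun k => cos_transform w k (t - k * xi)).
Proof.
move=> sw; apply: measurable_cos_transform; first exact: schwartz_integrable.
by apply: measurable_funB => //; exact: measurable_funM.
Qed.

Lemma rapid_fourier_wave : rapid (fun k => fourier f k * cexp ((k * xi)*i)).
Proof.
rewrite -[X in rapid X]/wave (funext waveE : wave = _).
split => /=.
- by apply: measurable_funB; [exact: (meas _ su)|exact: (meas _ sv)].
- by apply: measurable_funD; [exact: (meas _ sv)|exact: (meas _ su)].
- by apply: quartic_decayD; [exact: (quartic _ su)|exact/quartic_decayN/(quartic _ sv)].
- by apply: quartic_decayD; [exact: (quartic _ sv)|exact: (quartic _ su)].
Qed.

(** Real and imaginary parts are combinations of the real inversion formula with
    phases 0 and [pi / 2]; the latter contribute [cos (pi / 2) = 0]. *)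
Theorem fourier_inversion :
  Cintegral (fun k => fourier f k * cexp ((k * xi)*i)) = (2 * pi)%:C * f xi.
Proof.
rewrite (eq_Cintegral waveE).
have io w t : schwartz_real w ->
    mu.-integrable setT (EFin \o (fun k => cos_transform w k (t - k * xi))).
  move=> sw; have h : forall k, `|(1 : R)| <= 1 + `|k| by move=> k; rewrite normr1 lerDl.
  have ih := integrable_mul_quartic_decay (measurable_cst (1 : R))
    (meas t sw) h (quartic t sw).
  by apply: eq_integrable ih => // k _ /=; rewrite mul1r.
apply: complex_eqP; rewrite ?ReM ?ImM /=.
  rewrite RintegralB//; [|exact: io..].
  by rewrite !cos_transform_inversion// cos0 cos_pihalf; ring.
rewrite RintegralD//; [|exact: io..].
by rewrite !cos_transform_inversion// cos0 cos_pihalf; ring.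
Qed.

End Fourier.

(** * The bilinear operator *)

Section Main.
Local Open Scope classical_set_scope.
Variable R : realType.
Variable alpha : R.
Hypotheses (alpha_ge0 : 0 <= alpha) (alpha_le1 : alpha <= 1).
Variables (f g : R -> R[i]) (xi : R).
Hypotheses (sf : schwartz f) (sg : schwartz g).

Let m (k : R) : R[i] := cpow (k*i) alpha.
Let wave (h : R -> R[i]) k := fourier h k * cexp ((k * xi)*i).

Let im h : schwartz h -> Cintegrable (fun k => m k * wave h k).
Proof.
move=> sh; apply: Cintegrable_mul_rapid (rapid_fourier_wave xi sh).
- exact: measurable_Re_cpow_im.
- exact: measurable_Im_cpow_im.
- by move=> k; exact: Re_cpow_im_le.
- by move=> k; exact: Im_cpow_im_le.
Qed.

Let i1 h : schwartz h -> Cintegrable (wave h).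
Proof.
move=> sh.
apply: (@Cintegrable_ext _ (fun k => 1 * wave h k)).
  by move=> k; rewrite mul1r.
apply: Cintegrable_mul_rapid (rapid_fourier_wave xi sh) => /=.
- exact: measurable_cst.
- exact: measurable_cst.
- by move=> k; rewrite normr1 lerDl.
- by move=> k; rewrite normr0 addr_ge0.
Qed.

Let fracDE h : schwartz h ->
  fracD alpha h xi = ((2 * pi)^-1)%:C * Cintegral (fun k => m k * wave h k).
Proof.
move=> sh; rewrite fracD_schwartz// /inv_fourier; congr (_ * _).
by apply: eq_Cintegral => k; rewrite /m /wave mulrA.
Qed.

(** For fixed [k2] the inner integrand is a combination, with coefficients
    depending on [k2] only, of the two functions of [k1] that represent
    [fracD alpha f xi] and [f xi]; the same holds for the outer integral. *)
Lemma hirota_schwartz : hirota alpha f g xi =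
  (((2 * pi) ^+ 2)^-1)%:C *
  Cintegral (fun k2 : R => Cintegral (fun k1 : R =>
    (cpow (k1*i) alpha - cpow (k2*i) alpha)
    * fourier f k1 * fourier g k2 * cexp (((k1 + k2) * xi)*i))).
Proof.
have tpi : (2 * pi : R) != 0 by rewrite mulf_neq0// gt_eqF// pi_gt0.
have inv h : schwartz h -> h xi = ((2 * pi)^-1)%:C * Cintegral (wave h).
  by move=> sh; rewrite fourier_inversion// mulrA -rmorphM/= mulVf// mul1r.
pose A := Cintegral (fun k => m k * wave f k).
pose B := Cintegral (wave f).
have inner k2 : Cintegral (fun k1 : R =>
    (cpow (k1*i) alpha - cpow (k2*i) alpha)
    * fourier f k1 * fourier g k2 * cexp (((k1 + k2) * xi)*i)) =
    A * wave g k2 - B * (m k2 * wave g k2).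
  rewrite (eq_Cintegral (g := fun k1 => wave g k2 * (m k1 * wave f k1)
     - m k2 * wave g k2 * wave f k1)).
    rewrite CintegralB; [|exact/CintegrableZl/im|exact/CintegrableZl/i1].
    rewrite !CintegralZl; [|exact: i1|exact: im].
    by rewrite -/A -/B; ring.
  move=> k1; rewrite /m /wave.
  rewrite (_ : ((k1 + k2) * xi)*i = (k1 * xi)*i + (k2 * xi)*i); last first.
    by apply: complex_eqP => /=; rewrite ?addr0// mulrDl.
  by rewrite cexpD; ring.
rewrite (eq_Cintegral inner) CintegralB; [|exact/CintegrableZl/i1|exact/CintegrableZl/im].
rewrite !CintegralZl; [|exact: im|exact: i1].
rewrite /hirota !fracDE// (inv f)// (inv g)// -/A -/B.
by rewrite -exprVn expr2 rmorphM /=; ring.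
Qed.

End Main.

Unset Implicit Arguments.

Theorem proposition2p3 (R : realType) (alpha : R)
    (alpha_gt0 : 0 < alpha) (alpha_le1 : alpha <= 1) :
  (forall f g : R -> R[i], schwartz f -> schwartz g ->
     forall xi : R,
       hirota alpha f g xi =
       (((2 * pi) ^+ 2)^-1)%:C *
       Cintegral (fun k2 : R => Cintegral (fun k1 : R =>
         (cpow (k1*i) alpha - cpow (k2*i) alpha)
         * fourier f k1 * fourier g k2
         * cexp (((k1 + k2) * xi)*i))))
  /\
  (forall (k1 k2 delta1 delta2 : R[i]) (xi : R),
     hirota alpha (expfun k1 delta1) (expfun k2 delta2) xi =
     (cpow k1 alpha - cpow k2 alpha)
     * cexp ((k1 * xi%:C + delta1) + (k2 * xi%:C + delta2))).
Proof.
split=> [f g sf sg xi|k1 k2 d1 d2 xi]; last exact: hirota_expfun.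
exact: (hirota_schwartz (ltW alpha_gt0) alpha_le1).
Qed.
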